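(* Let $n\ge2$ and assume that $f$ satisfies (C1'), (C2), (C3') and (C4) stated in the context. Let $u$ be a solution of $$u''+\frac{n-1}{r}u'+f(u)=0,\qquad u(0)=\alpha>0,\quad u'(0)=0.$$ If there is $s_0\ge0$ such that $u(s_0)=u'(s_0)=0$, then one of the following holds: (i) $u(r)\equiv0$ for $r\in[s_0,\infty)$. (ii) There is $s_1\ge s_0$ such that $u\equiv0$ on $[s_0,s_1]$ and $u$ does not change sign on $(s_1,\infty)$. More precisely, $0<|u(r)|<\alpha_*$ for $r>s_1$, and $u$ oscillates about $1$ or $-1$.
   Context: $F(u)=\int_0^uf(s)\,ds$. Solutions are classical ($C^2$) on $[0,\infty)$. Conditions on $f$: (C1') $f\in C^1(\mathbb R\setminus\{0\})\cap C(\mathbb R)$; $f(u)<0$ for $u\in(0,1)$, $f(u)>0$ for $u\in(1,\infty)$, and $f(-u)=-f(u)$. (C2) There is some $\alpha_*>1$ such that $F(\alpha_* )=0$. (C3') There exists $q\in(1,2)$ such that $\lim_{u\to0^+}\frac{f'(u)}{-u^{q-2}}=q-1>0$. (C4) $f'(1)>0$. ''$u$ oscillates about $1$'' (on $(s_1,\infty)$) means that there are critical points $\tilde c_1<\tilde c_2<\cdots$ of $u$ there with $\alpha_*>u(\tilde c_1)>u(\tilde c_3)>\cdots>1$ and $0<u(\tilde c_2)<u(\tilde c_4)<\cdots<1$; ''$u$ oscillates about $-1$'' means that $-u$ oscillates about $1$. *)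

(* Defs.v *)
From Stdlib Require Import Reals.
From Coquelicot Require Import Coquelicot.
Open Scope R_scope.

Definition primitive (f : R -> R) (u : R) : R := RInt f 0 u.

Definition cond_C1' (f : R -> R) : Prop :=
  (forall x, x <> 0 -> ex_derive f x /\ continuous (Derive f) x) /\
  (forall x, continuous f x) /\
  (forall x, 0 < x < 1 -> f x < 0) /\
  (forall x, 1 < x -> 0 < f x) /\
  (forall x, f (- x) = - f x).

(* The zero [alpha_star] of the primitive is a parameter because the conclusion
   refers to it; the sign conditions in [cond_C1'] make it unique. *)
Definition cond_C2 (f : R -> R) (alpha_star : R) : Prop :=
  1 < alpha_star /\ primitive f alpha_star = 0.

Definition cond_C3' (f : R -> R) : Prop :=
  exists q, 1 < q < 2 /\
    filterlim (fun x => Derive f x / - Rpower x (q - 2))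
      (at_right 0) (locally (q - 1)).

(* [f] is differentiable at 1 by [cond_C1']. *)
Definition cond_C4 (f : R -> R) : Prop := 0 < Derive f 1.

Definition half_line (r : R) : Prop := 0 <= r.

(* [D_in] and [continue_in] are relative to the half line, so derivatives and
   continuity at the endpoint 0 are one-sided and the values of [u] at negative
   arguments are irrelevant.  The equation is singular at 0, where only the
   initial conditions are imposed. *)
Definition classical_solution (n : nat) (f : R -> R) (alpha : R)
    (u u' : R -> R) : Prop :=
  exists u'' : R -> R,
    (forall r, 0 <= r -> D_in u u' half_line r) /\
    (forall r, 0 <= r -> D_in u' u'' half_line r) /\
    (forall r, 0 <= r -> continue_in u'' half_line r) /\
    (forall r, 0 < r -> u'' r + (INR n - 1) / r * u' r + f (u r) = 0) /\
    u 0 = alpha /\ u' 0 = 0.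

(* [c k] is the critical point with one-based index [k + 1]: even [k] gives the
   values above 1, odd [k] those below 1. *)
Definition oscillates_about_1 (alpha_star s1 : R) (u : R -> R) : Prop :=
  exists c : nat -> R,
    (forall k, s1 < c k /\ is_derive u (c k) 0) /\
    (forall k, c k < c (S k)) /\
    u (c 0%nat) < alpha_star /\
    (forall k, u (c (2 * k + 2)%nat) < u (c (2 * k)%nat)) /\
    (forall k, 1 < u (c (2 * k)%nat)) /\
    0 < u (c 1%nat) /\
    (forall k, u (c (2 * k + 1)%nat) < u (c (2 * k + 3)%nat)) /\
    (forall k, u (c (2 * k + 1)%nat) < 1).

Definition oscillates_about_m1 (alpha_star s1 : R) (u : R -> R) : Prop :=
  oscillates_about_1 alpha_star s1 (fun r => - u r).

(* Main.v *)
(** The energy [u'^2/2 + F(u)] is nonincreasing in [r] and vanishes at [s0].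
    It can only stay equal to 0 as long as [u] stays equal to 0, so past the
    last zero [s1] it is negative, which confines [u] to [0 < |u| < alpha_star]
    and fixes its sign.

    On the other hand [r^(2(n-1)) (u'^2/2 + F(u) - F(1))] is nondecreasing and
    positive at [s0], so [u = 1] and [u' = 0] never happen together.  If [u]
    avoided the value 1 on some half line, then, [u] being bounded away from 0,
    [z = u'/(u-1)] would satisfy the Riccati inequality [z' <= -k(1+z^2)] for
    large [r], which has no global solution.  Hence [u - 1] has arbitrarily
    large zeros, all of them transversal, and [u] has critical points
    alternately above and below 1; their heights are ordered by the decay of
    the energy. *)

Require Import Defs.
From Stdlib Require Import Reals.
From Coquelicot Require Import Coquelicot.
From Stdlib Require Import Lra Lia Classical ClassicalEpsilon.
(* [RiemannInt] also exports a [primitive]. *)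
Import Defs.
Open Scope R_scope.

(** * Calculus on the line: monotonicity, interior extrema, a Riccati inequality *)

(** For [r > 0] all small increments stay in the half line, so the relative derivative is an
    ordinary two-sided one. *)
Lemma derivable_pt_lim_half_line (g g' : R -> R) (r : R) :
  0 < r -> D_in g g' half_line r -> derivable_pt_lim g r (g' r).
Proof.
  intros Hr HD eps Heps.
  destruct (HD eps Heps) as [d [Hd Hlim]].
  assert (Hm : 0 < Rmin d r) by (apply Rmin_glb_lt; lra).
  exists (mkposreal _ Hm); simpl; intros h Hh0 Hh.
  pose proof (Rmin_l d r); pose proof (Rmin_r d r).
  assert (Habs : - Rmin d r < h < Rmin d r) by (apply Rabs_def2 in Hh; lra).
  specialize (Hlim (r + h)); simpl in Hlim; unfold Rdist in Hlim.
  replace (r + h - r) with h in Hlim by ring.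
  apply Hlim; split; [split|]; unfold half_line; lra.
Qed.

Lemma derivable_pt_lim_nonpos_le (g g' : R -> R) (a b : R) :
  a <= b ->
  (forall x, a <= x <= b -> derivable_pt_lim g x (g' x)) ->
  (forall x, a < x < b -> g' x <= 0) ->
  g b <= g a.
Proof.
  intros Hab Hd Hneg.
  destruct (Req_dec a b) as [->|Hne]; [lra|].
  destruct (MVT_cor2 g g' a b) as [c [Hc Hcab]]; [lra|exact Hd|].
  specialize (Hneg c Hcab); nra.
Qed.

Lemma derivable_pt_lim_neg_lt (g g' : R -> R) (a b : R) :
  a < b ->
  (forall x, a <= x <= b -> derivable_pt_lim g x (g' x)) ->
  (forall x, a < x < b -> g' x < 0) ->
  g b < g a.
Proof.
  intros Hab Hd Hneg.
  destruct (MVT_cor2 g g' a b) as [c [Hc Hcab]]; [lra|exact Hd|].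
  specialize (Hneg c Hcab); nra.
Qed.

Lemma derivable_pt_lim_max_eq_0 (g : R -> R) (a b c l : R) :
  a < c < b -> derivable_pt_lim g c l ->
  (forall x, a < x < b -> g x <= g c) -> l = 0.
Proof.
  intros Hc Hd Hmax.
  exact (deriv_maximum g a b c (exist _ l Hd) (proj1 Hc) (proj2 Hc)
           (fun x H1 H2 => Hmax x (conj H1 H2))).
Qed.

(** The maximum over [[a, b]] is at least [g t], which exceeds both end values, so it is attained
    inside. *)
Lemma interior_max_critical (g g' : R -> R) (a t b : R) :
  a < t < b ->
  (forall x, a <= x <= b -> derivable_pt_lim g x (g' x)) ->
  g a < g t -> g b < g t ->
  exists c, a < c < b /\ g t <= g c /\ g' c = 0.
Proof.
  intros Ht Hd Ha Hb.
  destruct (continuity_ab_maj g a b) as [c [Hmax Hc]]; [lra| |].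
  { intros x Hx; apply derivable_continuous_pt.
    exists (g' x); apply Hd, Hx. }
  assert (Htc : g t <= g c) by (apply Hmax; lra).
  assert (Hca : c <> a) by (intros ->; lra).
  assert (Hcb : c <> b) by (intros ->; lra).
  exists c; split; [lra|split; [exact Htc|]].
  apply (derivable_pt_lim_max_eq_0 g a b c); [lra|apply Hd; lra|].
  intros x Hx; apply Hmax; lra.
Qed.

Lemma nonvanishing_constant_sign (g : R -> R) (a : R) :
  (forall r, a < r -> continuity_pt g r) ->
  (forall r, a < r -> g r <> 0) ->
  (forall r, a < r -> 0 < g r) \/ (forall r, a < r -> g r < 0).
Proof.
  intros Hc Hn.
  assert (Hneg : forall x y, a < x -> a < y -> g x < 0 -> 0 < g y -> False).
  { intros x y Hx Hy Hgx Hgy.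
    destruct (Rtotal_order x y) as [Hxy|[->|Hxy]]; [|lra|].
    - destruct (Ranalysis5.IVT_interv g x y) as [z [Hz Hgz]];
        [intros; apply Hc; lra|lra|lra|lra|].
      apply (Hn z); lra.
    - destruct (Ranalysis5.IVT_interv (- g)%F y x) as [z [Hz Hgz]];
        [intros; apply continuity_pt_opp, Hc; lra|lra|
         unfold opp_fct; lra|unfold opp_fct; lra|].
      unfold opp_fct in Hgz; apply (Hn z); lra. }
  destruct (Rdichotomy (g (a + 1)) 0) as [H|H]; [apply Hn; lra| |].
  - right; intros r Hr.
    destruct (Rdichotomy (g r) 0) as [H'|H']; [apply Hn, Hr|exact H'|].
    destruct (Hneg (a + 1) r); lra.
  - left; intros r Hr.
    destruct (Rdichotomy (g r) 0) as [H'|H']; [apply Hn, Hr| |exact H'].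
    destruct (Hneg r (a + 1)); lra.
Qed.

(** [atan (z r)] decreases at rate at least [k], yet [atan] takes values in an interval of length
    [PI]. *)
Lemma Riccati_no_global_solution (z z' : R -> R) (k a : R) :
  0 < k ->
  (forall r, a < r -> derivable_pt_lim z r (z' r)) ->
  (forall r, a < r -> z' r <= - k * (1 + z r ^ 2)) -> False.
Proof.
  intros Hk Hd Hz.
  assert (Hpi := PI_RGT_0).
  assert (Hlen : 0 < (PI + 1) / k) by (apply Rdiv_lt_0_compat; lra).
  (* Over this length the arctangent would drop by at least [PI + 1], more than its whole range. *)
  set (b := a + 1 + (PI + 1) / k).
  destruct (MVT_cor2 (fun r => atan (z r)) (fun r => / (1 + z r ^ 2) * z' r)
              (a + 1) b) as [c [Hc Hcab]].
  { unfold b; lra. }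
  { intros r Hr.
    apply (derivable_pt_lim_comp z atan); [apply Hd; lra|].
    apply derivable_pt_lim_atan. }
  assert (Hpos : 0 < 1 + z c ^ 2) by nra.
  assert (Hslope : / (1 + z c ^ 2) * z' c <= - k).
  { apply Rmult_le_reg_l with (1 + z c ^ 2); [exact Hpos|].
    rewrite <- Rmult_assoc, Rinv_r, Rmult_1_l by lra.
    specialize (Hz c ltac:(lra)); lra. }
  destruct (atan_bound (z b)); destruct (atan_bound (z (a + 1))).
  assert (Hdrop : k * (b - (a + 1)) = PI + 1) by (unfold b; field; lra).
  assert (0 < b - (a + 1)) by (unfold b; lra).
  nra.
Qed.

(** * The nonlinearity and its primitive [F] *)

Lemma derivable_pt_lim_primitive (f : R -> R) (x : R) :
  (forall y, continuous f y) -> derivable_pt_lim (primitive f) x (f x).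
Proof.
  intros Hc; apply is_derive_Reals; unfold primitive.
  apply is_derive_RInt with (a := 0); [|apply Hc].
  apply filter_forall; intros y; apply (RInt_correct (V := R_CompleteNormedModule)).
  apply (ex_RInt_continuous (V := R_CompleteNormedModule)); intros; apply Hc.
Qed.

Lemma primitive_0 (f : R -> R) : primitive f 0 = 0.
Proof. apply (RInt_point (V := R_CompleteNormedModule)). Qed.

Lemma odd_0 (f : R -> R) : cond_C1' f -> f 0 = 0.
Proof.
  intros (_ & _ & _ & _ & Hodd).
  specialize (Hodd 0); rewrite Ropp_0 in Hodd; lra.
Qed.

(** Otherwise [f] would keep the sign of [f 1] near 1, whereas it takes both signs there. *)
Lemma C1'_1 (f : R -> R) : cond_C1' f -> f 1 = 0.
Proof.
  intros (_ & Hc & Hneg & Hpos & _).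
  assert (Hc1 : continuity_pt f 1) by (apply continuity_pt_filterlim, Hc).
  destruct (Req_dec (f 1) 0) as [H0|H0]; [exact H0|exfalso].
  destruct (Hc1 (Rabs (f 1)) (Rabs_pos_lt _ H0)) as [d [Hd Hnear]].
  simpl in Hnear; unfold Rdist in Hnear.
  (* The cap [/ 2] keeps [1 - e] between 0 and 1, where [f] is negative. *)
  assert (Hm : 0 < Rmin (d / 2) (/ 2)) by (apply Rmin_glb_lt; lra).
  pose proof (Rmin_l (d / 2) (/ 2)); pose proof (Rmin_r (d / 2) (/ 2)).
  set (e := Rmin (d / 2) (/ 2)) in *.
  pose proof (Hneg (1 - e) ltac:(lra)) as Hl.
  pose proof (Hpos (1 + e) ltac:(lra)) as Hr.
  pose proof (Hnear (1 - e)) as Nl; pose proof (Hnear (1 + e)) as Nr.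
  assert (Rabs (f (1 - e) - f 1) < Rabs (f 1)) as Al.
  { apply Nl; split; [split; [exact I|lra]|].
    replace (1 - e - 1) with (- e) by ring.
    rewrite Rabs_Ropp, Rabs_pos_eq; lra. }
  assert (Rabs (f (1 + e) - f 1) < Rabs (f 1)) as Ar.
  { apply Nr; split; [split; [exact I|lra]|].
    replace (1 + e - 1) with e by ring.
    rewrite Rabs_pos_eq; lra. }
  revert Al Ar; unfold Rabs; repeat destruct Rcase_abs; lra.
Qed.

Lemma primitive_opp (f : R -> R) (x : R) :
  cond_C1' f -> primitive f (- x) = primitive f x.
Proof.
  intros (_ & Hc & _ & _ & Hodd).
  symmetry; apply (is_RInt_unique (V := R_CompleteNormedModule)).
  apply (is_RInt_ext (V := R_NormedModule) (fun y => opp (f (- y)))).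
  { intros y _; rewrite Hodd; unfold opp; simpl; ring. }
  apply (is_RInt_comp_opp (V := R_NormedModule)).
  rewrite Ropp_0; apply (RInt_correct (V := R_CompleteNormedModule)).
  apply (ex_RInt_continuous (V := R_CompleteNormedModule)); intros; apply Hc.
Qed.

Lemma primitive_Rabs (f : R -> R) (x : R) :
  cond_C1' f -> primitive f (Rabs x) = primitive f x.
Proof.
  intros HC; unfold Rabs; destruct Rcase_abs; [apply primitive_opp, HC|reflexivity].
Qed.

Lemma primitive_decreasing (f : R -> R) (x y : R) :
  cond_C1' f -> 0 <= x -> x < y -> y <= 1 -> primitive f y < primitive f x.
Proof.
  intros (_ & Hc & Hneg & _) Hx Hxy Hy.
  apply (derivable_pt_lim_neg_lt (primitive f) f x y Hxy).
  - intros; apply derivable_pt_lim_primitive, Hc.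
  - intros z Hz; apply Hneg; lra.
Qed.

Lemma primitive_increasing (f : R -> R) (x y : R) :
  cond_C1' f -> 1 <= x -> x < y -> primitive f x < primitive f y.
Proof.
  intros (_ & Hc & _ & Hpos & _) Hx Hxy.
  destruct (MVT_cor2 (primitive f) f x y Hxy) as [c [Heq Hc']].
  - intros; apply derivable_pt_lim_primitive, Hc.
  - specialize (Hpos c ltac:(lra)); nra.
Qed.

Lemma primitive_ge_1 (f : R -> R) (x : R) :
  cond_C1' f -> primitive f 1 <= primitive f x.
Proof.
  intros HC; rewrite <- (primitive_Rabs f x HC).
  pose proof (Rabs_pos x).
  destruct (Rtotal_order (Rabs x) 1) as [H1|[->|H1]]; [|lra|].
  - pose proof (primitive_decreasing f (Rabs x) 1 HC); lra.
  - pose proof (primitive_increasing f 1 (Rabs x) HC); lra.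
Qed.

(** [F] vanishes at 0 and at [astar] and increases past 1, so it is nonnegative from [astar] on;
    evenness covers negative [x]. *)
Lemma primitive_neg (f : R -> R) (astar x : R) :
  cond_C1' f -> cond_C2 f astar -> primitive f x < 0 -> 0 < Rabs x < astar.
Proof.
  intros HC [Ha HFa] Hx; split.
  - apply Rabs_pos_lt; intros ->; rewrite primitive_0 in Hx; lra.
  - rewrite <- (primitive_Rabs f x HC) in Hx.
    destruct (Rlt_le_dec (Rabs x) astar) as [H|H]; [exact H|exfalso].
    destruct (Req_dec (Rabs x) astar) as [He|He]; [rewrite He in Hx; lra|].
    pose proof (primitive_increasing f astar (Rabs x) HC); lra.
Qed.

(** The quotient [f x / (x - 1)] extends continuously to 1 with value [Derive f 1]. It is positive
    on [[a, b]], so its minimum there serves as [m]. *)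
Lemma restoring_force_lower_bound (f : R -> R) (a b : R) :
  cond_C1' f -> cond_C4 f -> 0 < a -> a <= b ->
  exists m, 0 < m /\
    forall x, a <= x <= b -> m * (x - 1) ^ 2 <= f x * (x - 1).
Proof.
  intros HC H4 Ha Hab.
  pose proof (C1'_1 f HC) as Hf1.
  destruct HC as (Hd & Hc & Hneg & Hpos & _).
  set (h := fun x => if Req_EM_T x 1 then Derive f 1 else f x / (x - 1)).
  assert (Hhc : forall x, continuity_pt h x).
  { intros x; destruct (Req_dec x 1) as [->|Hx].
    - intros eps Heps.
      destruct (proj1 (is_derive_Reals f 1 (Derive f 1))
                  (Derive_correct f 1 (proj1 (Hd 1 ltac:(lra)))) eps Heps)
        as [d Hlim].
      exists d; split; [apply cond_pos|].
      intros x [[_ Hx1] Hx]; simpl in *; unfold Rdist in *; unfold h.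
      destruct (Req_EM_T 1 1) as [_|]; [|lra].
      destruct (Req_EM_T x 1) as [->|_]; [lra|].
      specialize (Hlim (x - 1) ltac:(lra) Hx).
      replace (1 + (x - 1)) with x in Hlim by ring.
      rewrite Hf1, Rminus_0_r in Hlim; exact Hlim.
    - apply continuity_pt_ext_loc with (f := fun y => f y / (y - 1)).
      + apply (filter_imp (fun y => y <> 1)).
        * intros y Hy; unfold h; destruct (Req_EM_T y 1); [lra|reflexivity].
        * apply open_neq, Hx.
      + apply continuity_pt_div.
        * apply continuity_pt_filterlim, Hc.
        * reg.
        * lra. }
  destruct (continuity_ab_min h a b Hab) as [x0 [Hmin Hx0]].
  { intros; apply Hhc. }
  exists (h x0); split.
  - unfold h; destruct (Req_EM_T x0 1) as [_|Hx1]; [exact H4|].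
    destruct (Rdichotomy x0 1 Hx1) as [Hlt|Hgt].
    + specialize (Hneg x0 ltac:(lra)).
      replace (f x0 / (x0 - 1)) with ((- f x0) / (1 - x0)) by (field; lra).
      apply Rdiv_lt_0_compat; lra.
    + specialize (Hpos x0 Hgt); apply Rdiv_lt_0_compat; lra.
  - intros x Hx; specialize (Hmin x Hx).
    destruct (Req_dec x 1) as [->|Hx1]; [rewrite Hf1; lra|].
    replace (f x * (x - 1)) with (h x * (x - 1) ^ 2).
    + apply Rmult_le_compat_r; [apply pow2_ge_0|exact Hmin].
    + unfold h; destruct (Req_EM_T x 1); [lra|field; lra].
Qed.

(** * Radial solutions and their energy *)

(** [N] stands for [n - 1]. The equation is solved for the second derivative, and only [r > 0] is
    considered, where derivatives are two-sided. *)
Definition radial_solution (N : R) (f u u' : R -> R) : Prop :=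
  forall r, 0 < r ->
    derivable_pt_lim u r (u' r) /\
    derivable_pt_lim u' r (- (N / r * u' r) - f (u r)).

Definition energy (f u u' : R -> R) (r : R) : R :=
  u' r ^ 2 / 2 + primitive f (u r).

Lemma classical_radial_solution (n : nat) (f : R -> R) (alpha : R)
    (u u' : R -> R) :
  classical_solution n f alpha u u' -> radial_solution (INR n - 1) f u u'.
Proof.
  intros [u'' (H1 & H2 & _ & Heq & _)] r Hr; split.
  - apply derivable_pt_lim_half_line; [exact Hr|apply H1; lra].
  - replace (- ((INR n - 1) / r * u' r) - f (u r)) with (u'' r)
      by (specialize (Heq r Hr); lra).
    apply derivable_pt_lim_half_line; [exact Hr|apply H2; lra].
Qed.

Lemma radial_solution_opp (N : R) (f u u' : R -> R) :
  cond_C1' f -> radial_solution N f u u' ->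
  radial_solution N f (fun r => - u r) (fun r => - u' r).
Proof.
  intros (_ & _ & _ & _ & Hodd) Hs r Hr.
  destruct (Hs r Hr) as [H1 H2]; split.
  - apply derivable_pt_lim_opp, H1.
  - rewrite Hodd.
    replace (- (N / r * - u' r) - - f (u r))
      with (- (- (N / r * u' r) - f (u r))) by ring.
    apply (derivable_pt_lim_opp u'), H2.
Qed.

(** The two terms in [f u * u'] cancel, so only the loss due to damping remains. *)
Lemma derivable_pt_lim_energy (N : R) (f u u' : R -> R) (r : R) :
  cond_C1' f -> radial_solution N f u u' -> 0 < r ->
  derivable_pt_lim (energy f u u') r (- (N / r * u' r ^ 2)).
Proof.
  intros (_ & Hc & _) Hs Hr.
  destruct (Hs r Hr) as [H1 H2].
  pose proof (derivable_pt_lim_comp u (primitive f) r _ _ H1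
                (derivable_pt_lim_primitive f (u r) Hc)) as HF.
  pose proof (derivable_pt_lim_scal _ (/ 2) _ _
                (derivable_pt_lim_mult u' u' r _ _ H2 H2)) as HK.
  pose proof (derivable_pt_lim_plus _ _ _ _ _ HK HF) as HE.
  apply is_derive_Reals.
  apply is_derive_ext with
    (f := (mult_real_fct (/ 2) (u' * u') + comp (primitive f) u)%F).
  - intros x; unfold energy, plus_fct, mult_real_fct, mult_fct, comp.
    apply eq_trans with (/ 2 * (u' x * u' x) + primitive f (u x)); [reflexivity|].
    lra.
  - apply is_derive_Reals.
    replace (- (N / r * u' r ^ 2)) with
      (/ 2 * ((- (N / r * u' r) - f (u r)) * u' r
              + u' r * (- (N / r * u' r) - f (u r))) + f (u r) * u' r)
      by (field; lra).
    exact HE.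
Qed.

Lemma energy_nonincreasing (N : R) (f u u' : R -> R) (r s : R) :
  cond_C1' f -> radial_solution N f u u' -> 0 < N -> 0 < r -> r <= s ->
  energy f u u' s <= energy f u u' r.
Proof.
  intros HC Hs HN Hr Hrs.
  apply (derivable_pt_lim_nonpos_le _ (fun x => - (N / x * u' x ^ 2)) r s Hrs).
  - intros; apply derivable_pt_lim_energy; auto; lra.
  - intros x Hx; assert (0 < N / x) by (apply Rdiv_lt_0_compat; lra).
    pose proof (pow2_ge_0 (u' x)); nra.
Qed.

(** Monotonicity forces the energy to be constant on [[r, s]]; its derivative then vanishes inside,
    hence so does [u']. *)
Lemma energy_rigidity (N : R) (f u u' : R -> R) (r s : R) :
  cond_C1' f -> radial_solution N f u u' -> 0 < N -> 0 < r ->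
  energy f u u' r <= energy f u u' s ->
  forall x, r <= x <= s -> u x = u r.
Proof.
  intros HC Hs HN Hr HE x Hx.
  assert (Hconst : forall y, r <= y <= s -> energy f u u' y = energy f u u' r).
  { intros y Hy.
    pose proof (energy_nonincreasing N f u u' r y HC Hs HN).
    pose proof (energy_nonincreasing N f u u' y s HC Hs HN); lra. }
  destruct (Req_dec x r) as [->|Hne]; [reflexivity|].
  destruct (MVT_cor2 u u' r x) as [c [Heq Hc]]; [lra| |].
  { intros y Hy; apply Hs; lra. }
  assert (Hz : - (N / c * u' c ^ 2) = 0).
  { apply (derivable_pt_lim_max_eq_0 (energy f u u') r s c); [lra| |].
    - apply derivable_pt_lim_energy; auto; lra.
    - intros y Hy; rewrite (Hconst y), (Hconst c) by lra; lra. }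
  assert (0 < N / c) by (apply Rdiv_lt_0_compat; lra).
  assert (Hu' : u' c = 0).
  { destruct (Req_dec (u' c) 0) as [H0|H0]; [exact H0|exfalso].
    pose proof (Rmult_lt_0_compat _ _ H (pow2_gt_0 _ H0)); lra. }
  rewrite Hu' in Heq; lra.
Qed.

Lemma energy_gt_well (N : R) (f u u' : R -> R) (r s : R) :
  cond_C1' f -> radial_solution N f u u' -> 0 < N -> 0 < r ->
  primitive f 1 < energy f u u' r -> r <= s ->
  primitive f 1 < energy f u u' s.
Proof.
  intros HC Hs HN Hr HE Hrs.
  (* [w G] is nondecreasing, for [w = r^(2N)], because [u'^2 / 2 <= G]. *)
  set (G := fun x => energy f u u' x - primitive f 1).
  set (w := fun x => exp (2 * N * ln x)).
  assert (Hmono : - (w s * G s) <= - (w r * G r)).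
  { apply (derivable_pt_lim_nonpos_le (fun x => - (w x * G x))
      (fun x => - (2 * N / x * w x * G x + w x * - (N / x * u' x ^ 2))) r s Hrs).
    - intros x Hx.
      apply (derivable_pt_lim_opp (w * G)%F).
      apply (derivable_pt_lim_mult w G).
      + apply is_derive_Reals; unfold w; auto_derive; [lra|field; lra].
      + replace (- (N / x * u' x ^ 2)) with (- (N / x * u' x ^ 2) - 0) by ring.
        apply (derivable_pt_lim_minus (energy f u u') (fct_cte (primitive f 1))).
        * apply derivable_pt_lim_energy; auto; lra.
        * apply derivable_pt_lim_const.
    - intros x Hx.
      assert (0 < N / x) by (apply Rdiv_lt_0_compat; lra).
      assert (0 < w x) by apply exp_pos.
      assert (Hkin : u' x ^ 2 / 2 <= G x).
      { unfold G, energy; pose proof (primitive_ge_1 f (u x) HC); lra. }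
      (* The factor [G - u'^2 / 2] is [F(u) - F(1)], nonnegative by [Hkin]. *)
      replace (- (2 * N / x * w x * G x + w x * - (N / x * u' x ^ 2)))
        with (- (2 * (N / x * w x) * (G x - u' x ^ 2 / 2))) by (field; lra).
      assert (0 < N / x * w x) by (apply Rmult_lt_0_compat; lra).
      nra. }
  assert (0 < w r) by apply exp_pos; assert (0 < w s) by apply exp_pos.
  assert (0 < G r) by (unfold G; lra).
  assert (0 < w r * G r) by (apply Rmult_lt_0_compat; lra).
  assert (0 < G s) by (apply Rmult_lt_reg_l with (w s); lra).
  unfold G in *; lra.
Qed.

(** [F] is continuous with [F(0) = 0], so it exceeds [e] near 0. This will keep [u] in a compact set
    away from 0, where [f(u) / (u - 1)] has a positive lower bound. *)
Lemma negative_energy_lower_bound (f : R -> R) (e : R) :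
  cond_C1' f -> e < 0 ->
  exists a, 0 < a /\ forall x, 0 < x -> primitive f x <= e -> a < x.
Proof.
  intros HC He.
  assert (Hcont : continuity_pt (primitive f) 0).
  { apply derivable_continuous_pt; exists (f 0).
    apply derivable_pt_lim_primitive; apply HC. }
  destruct (Hcont (- e) ltac:(lra)) as [d [Hd Hnear]].
  simpl in Hnear; unfold Rdist in Hnear; rewrite primitive_0 in Hnear.
  exists (d / 2); split; [lra|].
  intros x Hx HF; apply Rnot_le_lt; intros Hle.
  assert (Habs : Rabs (primitive f x - 0) < - e).
  { apply Hnear; split; [split; [exact I|lra]|].
    rewrite Rminus_0_r, Rabs_pos_eq; lra. }
  apply Rabs_def2 in Habs; lra.
Qed.

(** * Oscillation about 1 *)

Lemma radial_solution_returns_to_1 (N : R) (f : R -> R) (astar : R)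
    (u u' : R -> R) (s1 a : R) :
  cond_C1' f -> cond_C2 f astar -> cond_C4 f ->
  radial_solution N f u u' -> 0 < N -> 0 < s1 ->
  (forall r, s1 < r -> 0 < u r) ->
  (forall r, s1 < r -> energy f u u' r < 0) ->
  s1 < a -> exists t, a < t /\ u t = 1.
Proof.
  intros HC H2 H4 Hs HN Hs1 Hpos HE Ha.
  apply NNPP; intros Hno.
  assert (Hne : forall r, a < r -> u r - 1 <> 0).
  { intros r Hr Hu; apply Hno; exists r; split; lra. }
  (* The energy at [a] is a negative upper bound for [F(u)] from then on, so the bounds on [u] are
     uniform in [r]. *)
  assert (HFa : forall r, a < r -> primitive f (u r) <= energy f u u' a).
  { intros r Hr.
    pose proof (energy_nonincreasing N f u u' a r HC Hs HN).
    unfold energy in *; pose proof (pow2_ge_0 (u' r)); lra. }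
  destruct (negative_energy_lower_bound f (energy f u u' a) HC (HE a Ha))
    as [b [Hb Hlow]].
  assert (Hrange : forall r, a < r -> b <= u r <= astar).
  { intros r Hr; split.
    - apply Rlt_le, Hlow; [apply Hpos; lra|apply HFa, Hr].
    - pose proof (HFa r Hr); pose proof (HE a Ha).
      destruct (primitive_neg f astar (u r) HC H2) as [_ Hlt]; [lra|].
      rewrite Rabs_pos_eq in Hlt; [lra|apply Rlt_le, Hpos; lra]. }
  destruct (restoring_force_lower_bound f b astar HC H4 Hb) as [m [Hm Hforce]].
  { destruct (Hrange (a + 1)); lra. }
  (* The estimate reached below is [z' <= - (m + z^2) / 2], so [k] must be at most [m / 2] and
     [/ 2]. *)
  set (k := Rmin m 1 / 2).
  assert (Hk : 0 < k) by (unfold k; pose proof (Rmin_glb_lt m 1 0); lra).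
  assert (Hkm : k <= m / 2 /\ k <= / 2)
    by (unfold k; pose proof (Rmin_l m 1); pose proof (Rmin_r m 1); lra).
  (* Beyond [A] the damping coefficient satisfies [(N/r)^2 <= m], so that the
     damping term [(N/r) z] is at most [(m + z^2) / 2]. *)
  set (A := a + N * (1 + / m)).
  assert (Hm' : 0 < / m) by (apply Rinv_0_lt_compat, Hm).
  assert (HA : a < A) by (unfold A; nra).
  apply (Riccati_no_global_solution
    (fun r => u' r / (u r - 1))
    (fun r => ((- (N / r * u' r) - f (u r)) * (u r - 1) - u' r * u' r)
              / (u r - 1)²) k A Hk).
  - intros r Hr; specialize (Hne r ltac:(lra)).
    destruct (Hs r ltac:(lra)) as [Hu Hu'].
    replace ((- (N / r * u' r) - f (u r)) * (u r - 1) - u' r * u' r)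
      with ((- (N / r * u' r) - f (u r)) * (u r - 1) - (u' r - 0) * u' r) by ring.
    apply (derivable_pt_lim_div u' (u - fct_cte 1)%F); [exact Hu'| |exact Hne].
    apply derivable_pt_lim_minus; [exact Hu|apply derivable_pt_lim_const].
  - intros r Hr; specialize (Hne r ltac:(lra)).
    (* In these terms [z' = - e z - h - z^2], with [h] the restoring quotient, at least [m]. *)
    set (z := u' r / (u r - 1)); set (e := N / r).
    set (h := f (u r) / (u r - 1)).
    replace (((- (e * u' r) - f (u r)) * (u r - 1) - u' r * u' r) / (u r - 1)²)
      with (- (e * z) - h - z ^ 2) by (unfold z, h, Rsqr; field; lra).
    assert (Hh : m <= h).
    { apply Rmult_le_reg_r with ((u r - 1) ^ 2); [apply pow2_gt_0, Hne|].
      replace (h * (u r - 1) ^ 2) with (f (u r) * (u r - 1))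
        by (unfold h; field; exact Hne).
      apply Hforce, Hrange; lra. }
    assert (Hr0 : 0 < r) by lra.
    assert (He0 : 0 < e) by (apply Rdiv_lt_0_compat; lra).
    assert (Her : e * r = N) by (unfold e; field; lra).
    assert (Hbig : N * (1 + / m) < r) by (unfold A in Hr; lra).
    assert (He1 : e * (1 + / m) < 1).
    { apply Rmult_lt_reg_r with r; [exact Hr0|].
      replace (e * (1 + / m) * r) with (e * r * (1 + / m)) by ring.
      rewrite Her; lra. }
    (* From [e (1 + / m) < 1] both [e < 1] and [e < m] follow, hence [e^2 <= m]. *)
    assert (He : e < 1) by nra.
    assert (Hem : e < m).
    { apply Rmult_lt_reg_r with (/ m); [exact Hm'|].
      rewrite Rinv_r by lra; nra. }
    assert (Hee : e ^ 2 <= m) by nra.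
    (* The first square bounds [- e z] by [(e^2 + z^2) / 2], which half of [h + z^2] absorbs. *)
    pose proof (pow2_ge_0 (e + z)); pose proof (pow2_ge_0 z).
    nra.
Qed.

(** If [u] stayed on one side of 1, [t] would be an extremum with [u' t = 0], and the energy there
    would be exactly [F(1)]. *)
Lemma radial_solution_crosses_1 (N : R) (f u u' : R -> R) (s1 t : R) :
  radial_solution N f u u' -> 0 < s1 < t -> u t = 1 ->
  primitive f 1 < energy f u u' t ->
  (exists r, s1 < r /\ 1 < u r) /\ (exists r, s1 < r /\ u r < 1).
Proof.
  intros Hs Ht Hut HE.
  assert (Hu' : u' t <> 0).
  { intros H0; unfold energy in HE; rewrite H0, Hut in HE; lra. }
  destruct (Hs t ltac:(lra)) as [Hd _].
  split; apply NNPP; intros Hno; apply Hu'.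
  - apply (derivable_pt_lim_max_eq_0 u s1 (t + 1) t); [lra|exact Hd|].
    intros x Hx; apply Rnot_lt_le; intros Hlt; apply Hno; exists x; lra.

    assert (- u' t = 0); [|lra].
    apply (derivable_pt_lim_max_eq_0 (fun x => - u x) s1 (t + 1) t);
      [lra|apply derivable_pt_lim_opp, Hd|].
    intros x Hx; apply Rnot_lt_le; intros Hlt; apply Hno; exists x; lra.
Qed.

(** Crossings of 1 recur forever, and critical points are picked between them one after another. At
    a critical point the energy equals [F(u)], so its decay orders the heights. *)
Lemma positive_radial_solution_oscillates (N : R) (f : R -> R) (astar : R)
    (u u' : R -> R) (s1 : R) :
  cond_C1' f -> cond_C2 f astar -> cond_C4 f ->
  radial_solution N f u u' -> 0 < N -> 0 < s1 ->
  (forall r, s1 < r -> 0 < u r) ->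
  (forall r, s1 < r -> primitive f 1 < energy f u u' r < 0) ->
  oscillates_about_1 astar s1 u.
Proof.
  intros HC H2 H4 Hs HN Hs1 Hpos HE.
  assert (Hcross : forall a, s1 < a ->
    (exists r, a < r /\ 1 < u r) /\ (exists r, a < r /\ u r < 1)).
  { intros a Ha.
    destruct (radial_solution_returns_to_1 N f astar u u' s1 a)
      as [t [Hat Hut]]; auto; [intros; apply HE; lra|].
    apply (radial_solution_crosses_1 N f u u' a t); auto; [lra|apply HE; lra]. }
  assert (Hd : forall x, s1 < x -> derivable_pt_lim u x (u' x))
    by (intros; apply Hs; lra).
  set (P := fun (k : nat) c => u' c = 0 /\
              if Nat.even k then 1 < u c else u c < 1).
  assert (Hcrit : forall k a, s1 < a -> exists c, a < c /\ P k c).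
  { intros k a Ha; unfold P; destruct (Nat.even k).
    - destruct (Hcross a Ha) as [_ [x [Hax Hx]]].
      destruct (Hcross x) as [[t [Hxt Ht]] _]; [lra|].
      destruct (Hcross t) as [_ [y [Hty Hy]]]; [lra|].
      destruct (interior_max_critical u u' x t y) as [c [Hc [Htc Hc0]]];
        [lra|intros; apply Hd; lra|lra|lra|].
      exists c; repeat split; lra.
    - destruct (Hcross a Ha) as [[x [Hax Hx]] _].
      destruct (Hcross x) as [_ [t [Hxt Ht]]]; [lra|].
      destruct (Hcross t) as [[y [Hty Hy]] _]; [lra|].
      destruct (interior_max_critical (fun r => - u r) (fun r => - u' r) x t y)
        as [c [Hc [Htc Hc0]]];
        [lra|intros; apply derivable_pt_lim_opp, Hd; lra|lra|lra|].
      exists c; repeat split; lra. }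
  (* With [s1 < a] under the existential the choice function is total in [a]; the witness 0 is a
     dummy for [a <= s1]. *)
  assert (Hstep : forall k a, exists c, s1 < a -> a < c /\ P k c).
  { intros k a; destruct (Rlt_le_dec s1 a) as [Ha|Ha].
    - destruct (Hcrit k a Ha) as [c Hc]; exists c; auto.
    - exists 0; lra. }
  set (step := fun k a =>
    proj1_sig (constructive_indefinite_description _ (Hstep k a))).
  assert (Hstep' : forall k a, s1 < a -> a < step k a /\ P k (step k a)).
  { intros k a.
    exact (proj2_sig (constructive_indefinite_description _ (Hstep k a))). }
  set (c := fix c k := match k with
                       | O => step O (s1 + 1)
                       | S k' => step (S k') (c k')
                       end).
  assert (Hc : forall k, s1 < c k /\ P k (c k)).
  { induction k as [|k [IH _]].
    - destruct (Hstep' O (s1 + 1)); [lra|]; split; simpl; [lra|assumption].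
    - destruct (Hstep' (S k) (c k) IH); split; simpl in *; [lra|assumption]. }
  assert (Hinc : forall k, c k < c (S k)).
  { intros k; destruct (Hc k) as [Hk _]; apply (Hstep' (S k) (c k) Hk). }
  assert (Hup : forall k, 1 < u (c (2 * k)%nat)).
  { intros k; destruct (Hc (2 * k)%nat) as [_ [_ H]].
    rewrite Nat.even_mul in H; exact H. }
  assert (Hdown : forall k, u (c (2 * k + 1)%nat) < 1).
  { intros k; destruct (Hc (2 * k + 1)%nat) as [_ [_ H]].
    rewrite Nat.even_add, Nat.even_mul in H; exact H. }
  assert (Henergy : forall k, energy f u u' (c k) = primitive f (u (c k))).
  { intros k; destruct (Hc k) as [_ [H _]]; unfold energy; rewrite H; lra. }
  (* Without a strict drop, [u] would be constant from [c k] to [c (S (S k))], against its different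
     value at [c (S k)]. *)
  assert (Hdecay : forall k, u (c (S k)) <> u (c k) ->
    primitive f (u (c (S (S k)))) < primitive f (u (c k))).
  { intros k Hk; rewrite <- !Henergy.
    apply Rnot_le_lt; intros Hle; apply Hk.
    pose proof (Hinc k); pose proof (Hinc (S k)); pose proof (proj1 (Hc k)).
    apply (energy_rigidity N f u u' (c k) (c (S (S k)))); auto; lra. }
  exists c.
  refine (conj _ (conj Hinc (conj _ (conj _ (conj Hup (conj _ (conj _ Hdown))))))).
  - intros k; destruct (Hc k) as [Hk [H0 _]]; split; [exact Hk|].
    rewrite <- H0; apply is_derive_Reals, Hd, Hk.
  - destruct (Hc 0%nat) as [H0 _].
    destruct (primitive_neg f astar (u (c 0%nat)) HC H2) as [_ H].
    + rewrite <- Henergy; apply HE, H0.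
    + rewrite Rabs_pos_eq in H; [exact H|apply Rlt_le, Hpos, H0].
  (* The critical point below 1 in between rules out constancy; [F] increases above 1, so a smaller
     [F] means a smaller height. *)
  - intros k; pose proof (Hup k) as Ha; pose proof (Hdown k) as Hb.
    pose proof (Hup (k + 1)%nat) as Ha'.
    replace (2 * (k + 1))%nat with (2 * k + 2)%nat in Ha' by lia.
    pose proof (Hdecay (2 * k)%nat) as HF.
    replace (S (S (2 * k))) with (2 * k + 2)%nat in HF by lia.
    replace (S (2 * k)) with (2 * k + 1)%nat in HF by lia.
    specialize (HF ltac:(lra)).
    apply Rnot_le_lt; intros [Hlt|Heq]; [|rewrite Heq in HF; lra].
    pose proof (primitive_increasing f _ _ HC (Rlt_le _ _ Ha) Hlt); lra.
  - apply Hpos, Hc.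
  (* Here [F] decreases on [[0, 1]], so a smaller [F] means a larger value. *)
  - intros k; pose proof (Hdown k) as Ha; pose proof (Hup (k + 1)%nat) as Hb.
    pose proof (Hdown (k + 1)%nat) as Ha'.
    replace (2 * (k + 1))%nat with (2 * k + 2)%nat in Hb by lia.
    replace (2 * (k + 1) + 1)%nat with (2 * k + 3)%nat in Ha' by lia.
    pose proof (Hdecay (2 * k + 1)%nat) as HF.
    replace (S (S (2 * k + 1))) with (2 * k + 3)%nat in HF by lia.
    replace (S (2 * k + 1)) with (2 * k + 2)%nat in HF by lia.
    specialize (HF ltac:(lra)).
    apply Rnot_le_lt; intros [Hlt|Heq]; [|rewrite Heq in HF; lra].
    pose proof (Hpos (c (2 * k + 3)%nat) (proj1 (Hc _))) as H0.
    pose proof (primitive_decreasing f _ _ HC (Rlt_le _ _ H0) Hlt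
                  (Rlt_le _ _ Ha)); lra.
Qed.

(** * Symmetry, the initial zero interval and the conclusion *)

Lemma energy_opp (f u u' : R -> R) (r : R) :
  cond_C1' f -> energy f (fun x => - u x) (fun x => - u' x) r = energy f u u' r.
Proof.
  intros HC; unfold energy; rewrite primitive_opp by exact HC.
  replace ((- u' r) ^ 2) with (u' r ^ 2) by ring; reflexivity.
Qed.

(** [s1] is the supremum of the [s] such that [u] vanishes on [[s0, s]]. The last clause only yields
    a nonzero value somewhere up to [r]; the energy later excludes all zeros past [s1]. *)
Lemma initial_zero_interval (u : R -> R) (s0 : R) :
  u s0 = 0 -> (forall r, s0 < r -> continuity_pt u r) ->
  (forall r, s0 <= r -> u r = 0) \/
  exists s1, s0 <= s1 /\ (forall r, s0 <= r <= s1 -> u r = 0) /\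
    forall r, s1 < r -> exists x, s0 <= x <= r /\ u x <> 0.
Proof.
  intros H0 Hc.
  destruct (classic (forall r, s0 <= r -> u r = 0)) as [Hall|Hall]; [left; exact Hall|].
  right.
  apply not_all_ex_not in Hall; destruct Hall as [r1 Hr1].
  apply imply_to_and in Hr1; destruct Hr1 as [Hr1 Hur1].
  set (Z := fun s => s0 <= s /\ forall r, s0 <= r <= s -> u r = 0).
  assert (HZ0 : Z s0).
  { split; [lra|]; intros r Hr; replace r with s0 by lra; exact H0. }
  destruct (completeness Z) as [s1 [Hub Hlub]].
  { exists r1; intros s [_ Hs]; apply Rnot_lt_le; intros Hlt.
    apply Hur1, Hs; lra. }
  { exists s0; exact HZ0. }
  assert (Hle : s0 <= s1) by (apply Hub, HZ0).
  assert (Hbelow : forall r, s0 <= r < s1 -> u r = 0).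
  { intros r Hr; apply NNPP; intros Hur.
    assert (s1 <= r); [|lra].
    apply Hlub; intros s [_ Hs]; apply Rnot_lt_le; intros Hlt.
    apply Hur, Hs; lra. }
  exists s1; split; [exact Hle|split].
  - intros r Hr; destruct (Req_dec r s1) as [->|Hne]; [|apply Hbelow; lra].
    destruct (Req_dec s1 s0) as [->|Hne]; [exact H0|].
    apply NNPP; intros Hus1.
    destruct (Hc s1 ltac:(lra) (Rabs (u s1)) (Rabs_pos_lt _ Hus1))
      as [d [Hd Hnear]].
    simpl in Hnear; unfold Rdist in Hnear.
    (* The cap [s1 - s0] keeps [s1 - e] at or after [s0], where [u] is known to vanish. *)
    assert (Hm : 0 < Rmin (d / 2) (s1 - s0)) by (apply Rmin_glb_lt; lra).
    pose proof (Rmin_l (d / 2) (s1 - s0)); pose proof (Rmin_r (d / 2) (s1 - s0)).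
    set (e := Rmin (d / 2) (s1 - s0)) in *.
    assert (Habs : Rabs (u (s1 - e) - u s1) < Rabs (u s1)).
    { apply Hnear; split; [split; [exact I|lra]|].
      replace (s1 - e - s1) with (- e) by ring.
      rewrite Rabs_Ropp, Rabs_pos_eq; lra. }
    rewrite Hbelow, Rminus_0_l, Rabs_Ropp in Habs by lra; lra.
  - intros r Hr; apply NNPP; intros Hno.
    assert (r <= s1); [|lra].
    apply Hub; split; [lra|].
    intros x Hx; apply NNPP; intros Hux; apply Hno; exists x; auto.
Qed.

Theorem lemma2p7 (n : nat) (hn : (2 <= n)%nat) (f : R -> R) (alpha_star : R)
    (hC1 : cond_C1' f) (hC2 : cond_C2 f alpha_star)
    (hC3 : cond_C3' f) (hC4 : cond_C4 f)
    (alpha : R) (halpha : 0 < alpha) (u u' : R -> R)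
    (hu : classical_solution n f alpha u u')
    (s0 : R) (hs0 : 0 <= s0) (hus0 : u s0 = 0) (hu's0 : u' s0 = 0) :
  (forall r, s0 <= r -> u r = 0) \/
  (exists s1, s0 <= s1 /\
     (forall r, s0 <= r <= s1 -> u r = 0) /\
     ((forall r, s1 < r -> 0 <= u r) \/ (forall r, s1 < r -> u r <= 0)) /\
     (forall r, s1 < r -> 0 < Rabs (u r) < alpha_star) /\
     (oscillates_about_1 alpha_star s1 u \/
      oscillates_about_m1 alpha_star s1 u)).
Proof.
  assert (HN : 0 < INR n - 1) by (apply le_INR in hn; simpl in hn; lra).
  (* At radius 0 the solution has the value [alpha > 0], so [s0 = 0] is impossible. *)
  assert (Hs0 : 0 < s0).
  { destruct hs0 as [H|<-]; [exact H|].
    destruct hu as [u'' (_ & _ & _ & _ & Ha & _)]; lra. }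
  pose proof (classical_radial_solution n f alpha u u' hu) as Hs.
  assert (Hcont : forall r, s0 < r -> continuity_pt u r).
  { intros r Hr; apply derivable_continuous_pt.
    exists (u' r); apply Hs; lra. }
  assert (HEs0 : energy f u u' s0 = 0).
  { unfold energy; rewrite hus0, hu's0, primitive_0; lra. }
  destruct (initial_zero_interval u s0 hus0 Hcont)
    as [Hz|[s1 (Hs01 & Hz & Hlast)]]; [left; exact Hz|right].
  assert (HE : forall r, s1 < r -> primitive f 1 < energy f u u' r < 0).
  { intros r Hr; split.
    (* The energy at [s0] is [F(0) = 0], strictly above [F(1)]. *)
    - apply (energy_gt_well (INR n - 1) f u u' s0 r); auto; [|lra].
      rewrite HEs0, <- (primitive_0 f).
      apply primitive_decreasing; auto; lra.
    (* A nonnegative energy at [r] would force [u = 0] on all of [[s0, r]], against the choice of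
       [s1]. *)
    - apply Rnot_le_lt; intros Hle.
      destruct (Hlast r Hr) as [x [Hx Hux]]; apply Hux.
      rewrite <- hus0.
      apply (energy_rigidity (INR n - 1) f u u' s0 r); auto; lra. }
  assert (Hbound : forall r, s1 < r -> 0 < Rabs (u r) < alpha_star).
  { intros r Hr; apply (primitive_neg f); auto.
    pose proof (HE r Hr); pose proof (pow2_ge_0 (u' r)).
    unfold energy in *; lra. }
  assert (Hne : forall r, s1 < r -> u r <> 0).
  { intros r Hr H0; pose proof (Hbound r Hr) as [H _].
    rewrite H0, Rabs_R0 in H; lra. }
  exists s1; split; [exact Hs01|split; [exact Hz|]].
  destruct (nonvanishing_constant_sign u s1) as [Hp|Hm];
    [intros; apply Hcont; lra|exact Hne| |].
  - split; [left; intros; apply Rlt_le, Hp; assumption|].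
    split; [exact Hbound|left].
    apply (positive_radial_solution_oscillates (INR n - 1) f alpha_star u u');
      auto; lra.
  (* Since [f] is odd, the negative case is the positive one for [- u]. *)
  - split; [right; intros; apply Rlt_le, Hm; assumption|].
    split; [exact Hbound|right].
    apply (positive_radial_solution_oscillates (INR n - 1) f alpha_star
             (fun r => - u r) (fun r => - u' r)); auto; [|lra| |].
    + apply radial_solution_opp; assumption.
    + intros r Hr; specialize (Hm r Hr); lra.
    + intros r Hr; rewrite energy_opp by exact hC1; apply HE, Hr.
Qed.
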